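(* Let $\kappa \in \mathcal{S}_{-1}$ and let $k$ be its associate Sonine kernel. Then for every function $f\in C_{-1}^1(0,+\infty)$ the following relations hold: $$(\mathbb{I}_{(\kappa)}\, {}_*\mathbb{D}_{(k)}\, f)(t) = f(t)-f(0),\quad t>0,$$ $$(\mathbb{I}_{(\kappa)}\, \mathbb{D}_{(k)}\, f)(t) = f(t),\quad t>0.$$
   Context: Functions on $(0,+\infty)$ are real-valued (or all complex-valued). $C_{-1}(0,+\infty)$ is the set of functions $f$ on $(0,+\infty)$ that can be written as $f(t)=t^{p-1}f_1(t)$, $t>0$, for some $p>0$ and some $f_1\in C[0,+\infty)$. $C_{-1,0}(0,+\infty)$ is the set of functions $f$ on $(0,+\infty)$ that can be written as $f(t)=t^{p-1}f_1(t)$, $t>0$, for some $0<p<1$ and some $f_1\in C[0,+\infty)$. (The exponents $p$ depend on $f$.) $C_{-1}^1(0,+\infty)$ is the set of functions $f$ differentiable on $(0,+\infty)$ with $f'\in C_{-1}(0,+\infty)$; for such $f$ the finite limit $f(0):=\lim_{t\to0+}f(t)$ exists. The Laplace convolution is $(f*g)(t)=\int_0^t f(t-\tau)g(\tau)\,d\tau$, $t>0$. $\kappa\in\mathcal{S}_{-1}$ means that $\kappa\in C_{-1,0}(0,+\infty)$ and there is $k\in C_{-1,0}(0,+\infty)$ with $(\kappa*k)(t)=1$ for all $t>0$ (the Sonine condition). Such a $k$ is unique and is called the associate Sonine kernel of $\kappa$. The general fractional integral with kernel $\kappa$ is $(\mathbb{I}_{(\kappa)} f)(t)=(\kappa*f)(t)$,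 $t>0$. The general fractional derivatives of Riemann--Liouville and Caputo type with kernel $k$ are $$(\mathbb{D}_{(k)} f)(t)=\frac{d}{dt}(k*f)(t),\qquad ({}_*\mathbb{D}_{(k)} f)(t)=(\mathbb{D}_{(k)} f)(t)-f(0)k(t),\qquad t>0.$$ *)

(* Defs.v *)
From HB Require Import structures.
From mathcomp Require Import all_boot all_order all_algebra.
From mathcomp Require Import complex.
From mathcomp Require Import all_classical all_reals all_analysis.

Set Implicit Arguments.
Unset Strict Implicit.
Unset Printing Implicit Defensive.

Import Order.TTheory GRing.Theory Num.Theory.
Import numFieldNormedType.Exports.

Local Open Scope classical_set_scope.
Local Open Scope ring_scope.

(* A function on (0,+oo) is a total function on R; none of the notions below
   depends on its values at nonpositive arguments. *)

Section real_valued.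
Context {R : realType}.
Implicit Types f g k kappa : R -> R.

Definition factors_at (p : R) f : Prop :=
  exists2 f1 : R -> R, {within `[0, +oo[, continuous f1} &
    forall t : R, 0 < t -> f t = t `^ (p - 1) * f1 t.

Definition C_m1 f : Prop := exists2 p : R, 0 < p & factors_at p f.

Definition C_m1_0 f : Prop := exists2 p : R, 0 < p < 1 & factors_at p f.

Definition C1_m1 f : Prop :=
  (forall t : R, 0 < t -> derivable f t 1) /\ C_m1 f^`()%classic.

(* For functions in C_m1 the improper integral of the convolution converges
   absolutely, hence agrees with the Lebesgue integral. *)
Definition conv f g (t : R) : R :=
  \int[@lebesgue_measure R]_(tau in `]0, t[) (f (t - tau) * g tau).

Definition conv_defined f g (t : R) : Prop :=
  (@lebesgue_measure R).-integrable `]0, t[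
    (fun tau => (f (t - tau) * g tau)%:E).

Definition associate_kernel kappa k : Prop :=
  C_m1_0 k /\ forall t : R, 0 < t -> conv kappa k t = 1.

Definition S_m1 kappa : Prop :=
  C_m1_0 kappa /\ exists k : R -> R, associate_kernel kappa k.

Definition val0 f : R := lim (f t @[t --> 0^'+]).

Definition GFI kappa f : R -> R := conv kappa f.

Definition GFD_RL k f : R -> R := (conv k f)^`()%classic.

Definition GFD_C k f (t : R) : R := GFD_RL k f t - val0 f * k t.

(* The library's limits, derivatives and integrals are total: these predicates
   say that the ones occurring in the operators exist. *)
Definition val0_defined f : Prop := cvg (f t @[t --> 0^'+]).

Definition GFD_RL_defined k f : Prop :=
  forall t : R, 0 < t ->
    (conv_defined k f t /\ derivable (conv k f) t 1).

Definition GFD_C_defined k f : Prop := val0_defined f /\ GFD_RL_defined k f.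

End real_valued.

(* Complex-valued functions of a real variable: continuity, limits,
   derivatives and integrals are taken on real and imaginary parts. *)
Section complex_valued.
Context {R : realType}.
Local Open Scope complex_scope.
Implicit Types f g k kappa : R -> R[i].

Definition re f (t : R) : R := complex.Re (f t).
Definition im f (t : R) : R := complex.Im (f t).

Definition cderivable f (t : R) : Prop :=
  derivable (re f) t 1 /\ derivable (im f) t 1.

Definition cderive f (t : R) : R[i] := (re f)^`()%classic t +i* (im f)^`()%classic t.

Definition cfactors_at (p : R) f : Prop :=
  exists2 f1 : R -> R[i],
    {within `[0, +oo[, continuous (re f1)} /\
    {within `[0, +oo[, continuous (im f1)} &
    forall t : R, 0 < t -> f t = (t `^ (p - 1))%:C * f1 t.

Definition cC_m1 f : Prop := exists2 p : R, 0 < p & cfactors_at p f.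

Definition cC_m1_0 f : Prop := exists2 p : R, 0 < p < 1 & cfactors_at p f.

Definition cC1_m1 f : Prop :=
  (forall t : R, 0 < t -> cderivable f t) /\ cC_m1 (cderive f).

Definition cintegrand f g (t tau : R) : R[i] := f (t - tau) * g tau.

Definition cconv f g (t : R) : R[i] :=
  (\int[@lebesgue_measure R]_(tau in `]0, t[) re (cintegrand f g t) tau) +i*
  (\int[@lebesgue_measure R]_(tau in `]0, t[) im (cintegrand f g t) tau).

Definition cconv_defined f g (t : R) : Prop :=
  (@lebesgue_measure R).-integrable `]0, t[
    (fun tau => (re (cintegrand f g t) tau)%:E) /\
  (@lebesgue_measure R).-integrable `]0, t[
    (fun tau => (im (cintegrand f g t) tau)%:E).

Definition cassociate_kernel kappa k : Prop :=
  cC_m1_0 k /\ forall t : R, 0 < t -> cconv kappa k t = 1.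

Definition cS_m1 kappa : Prop :=
  cC_m1_0 kappa /\ exists k : R -> R[i], cassociate_kernel kappa k.

Definition cval0 f : R[i] := val0 (re f) +i* val0 (im f).

Definition cGFI kappa f : R -> R[i] := cconv kappa f.

Definition cGFD_RL k f : R -> R[i] := cderive (cconv k f).

Definition cGFD_C k f (t : R) : R[i] := cGFD_RL k f t - cval0 f * k t.

Definition cval0_defined f : Prop :=
  val0_defined (re f) /\ val0_defined (im f).

Definition cGFD_RL_defined k f : Prop :=
  forall t : R, 0 < t ->
    (cconv_defined k f t /\ cderivable (cconv k f) t).

Definition cGFD_C_defined k f : Prop :=
  cval0_defined f /\ cGFD_RL_defined k f.

End complex_valued.

(* Main.v *)
(* For t > 0 put (1 * g)(t) = int_0^t g.  A function f in C_{-1}^1 is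
   f = f(0) + 1 * f', so associativity and commutativity of the convolution
   give k * f = 1 * (f(0) k + k * f').  As f(0) k + k * f' is continuous on
   (0,+oo), this yields D_(k) f = f(0) k + k * f', hence *D_(k) f = k * f'.
   Then kappa * (k * f') = (kappa * k) * f' = 1 * f' = f - f(0), while
   kappa * (f(0) k) = f(0).
   All of this takes place in the algebra of functions that are continuous on
   (0,+oo) and O(t^(p-1)) on every (0,T] for some 0 < p <= 1.  Rescaling
   (f * g)(t) = t int_0^1 f(t(1-s)) g(ts) ds dominates the integrand by a
   multiple of the Beta kernel (1-s)^(p-1) s^(q-1), which gives convergence,
   the growth bound and (by dominated convergence) continuity. *)
Require Import Defs.
From HB Require Import structures.
From mathcomp Require Import all_boot all_order all_algebra.
From mathcomp Require Import complex.
From mathcomp Require Import all_classical all_reals all_analysis.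
From mathcomp Require Import measurable_realfun ring lra.

Set Implicit Arguments.
Unset Strict Implicit.
Unset Printing Implicit Defensive.

Import Order.TTheory GRing.Theory Num.Theory.
Import numFieldNormedType.Exports.

Local Open Scope classical_set_scope.
Local Open Scope ring_scope.

(** * Affine change of variable in Lebesgue integrals *)

Section affine_change_of_variable.
Context {R : realType}.
Notation mu := (@lebesgue_measure R).
Variables a b : R.
Hypothesis a0 : a != 0.
Let aff : measurableTypeR R -> measurableTypeR R := fun x : R => a * x + b.

Lemma measurable_affine : measurable_fun setT aff.
Proof. by apply: measurable_funD => //; exact: measurable_funM. Qed.

Let affmu : {measure set (measurableTypeR R) -> \bar R}.
Proof.
unshelve refine
  (pushforward mu aff : {measure set (measurableTypeR R) -> \bar R}).
exact: measurable_affine.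
Defined.

(** By uniqueness of Lebesgue measure: [|a|] times the pushforward is a measure, so it is enough to
    compare lengths on the intervals []u, v]]. *)
Lemma lebesgue_measure_affine (A : set R) : measurable A ->
  (`|a|%:E * mu (aff @^-1` A) = mu A)%E.
Proof.
move=> mA.
have a_ge0 : 0 <= `|a| by [].
pose m : {measure set (measurableTypeR R) -> \bar R} :=
  mscale (NngNum a_ge0) affmu.
transitivity (m A) => //.
apply/esym/lebesgue_measure_unique => // _ [[u v] _ <-].
rewrite -[RHS]/(`|a|%:E * mu (aff @^-1` `]u, v]))%E.
have [a_gt0|a_lt0|] := ltgtP 0 a; last by move/eqP; rewrite eq_sym (negbTE a0).
- have -> : aff @^-1` `]u, v] = `]((u - b) / a), ((v - b) / a)]%classic.
    by apply/seteqP; split=> x /=; rewrite !in_itv/= /aff ltr_pdivrMr//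
      ler_pdivlMr// ltrBlDr lerBrDr mulrC.
  rewrite !lebesgue_measure_itv/= !lte_fin ltr_pM2r ?invr_gt0// ltrD2r.
  case: ifPn => _; last by rewrite mule0.
  rewrite -!EFinB -EFinM gtr0_norm//; congr EFin; field; exact: lt0r_neq0.
(* A negative slope swaps the endpoints, so the preimage is closed on the left and open on the
   right; its length is unaffected. *)
- have -> : aff @^-1` `]u, v] = `[((v - b) / a), ((u - b) / a)[%classic.
    by apply/seteqP; split=> x /=; rewrite !in_itv/= /aff ler_ndivrMr//
      ltr_ndivlMr// ltrBlDr lerBrDr [x * a]mulrC andbC.
  rewrite !lebesgue_measure_itv/= !lte_fin ltr_nM2r ?invr_lt0// ltrD2r.
  case: ifPn => _; last by rewrite mule0.
  rewrite -!EFinB -EFinM ltr0_norm//; congr EFin; field; exact: ltr0_neq0.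
Qed.

Lemma ge0_integral_affine (D : set R) (f : R -> \bar R) :
  measurable D -> measurable_fun D f -> {in D, forall y, 0 <= f y}%E ->
  (\int[mu]_(y in D) f y = `|a|%:E * \int[mu]_(x in aff @^-1` D) f (aff x))%E.
Proof.
move=> mD mf f0.
have a_ge0 : 0 <= `|a| by [].
have /= <- := ge0_integral_pushforward measurable_affine mu mD mf f0.
rewrite -(ge0_integral_mscale affmu mD (NngNum a_ge0))//.
  apply: eq_measure_integral => //= A mA AS.
  by rewrite /mscale/= lebesgue_measure_affine.
by move=> x Dx; apply: f0; rewrite inE.
Qed.

Lemma measurable_preimage_affine (D : set R) :
  measurable D -> measurable (aff @^-1` D).
Proof.
by move=> mD; rewrite -[X in measurable X]setTI; exact: measurable_affine.
Qed.

Lemma measurable_fun_comp_affine (D : set R) (f : R -> \bar R) :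
  measurable D -> measurable_fun D f ->
  measurable_fun (aff @^-1` D) (f \o aff).
Proof.
move=> mD mf; apply: (measurable_comp mD) => //.
  by move=> _ [x ? <-].
exact: measurable_funS measurable_affine.
Qed.

Lemma integrable_affine (D : set R) (f : R -> \bar R) : measurable D ->
  mu.-integrable D f -> mu.-integrable (aff @^-1` D) (f \o aff).
Proof.
move=> mD /integrableP[mf foo]; apply/integrableP; split.
  exact: measurable_fun_comp_affine.
move: foo; rewrite ge0_integral_affine//; last exact: measurableT_comp.
(* Since [|a| > 0], an infinite [I] would make the finite product [|a| * I] infinite. *)
set I := (X in (_ * X)%E); rewrite -[X in (_ -> X < _)%E]/I.
have : (0 <= I)%E by rewrite /I; apply: integral_ge0 => x _; exact: abse_ge0.
case: I => [r _ _|_|//]; first by rewrite ltry.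
by rewrite gt0_muley ?lte_fin ?normr_gt0// ltxx.
Qed.

(** The nonnegative case is applied separately to the positive and negative parts of [f]. *)
Lemma Rintegral_affine (D : set R) (f : R -> R) : measurable D ->
  mu.-integrable D (EFin \o f) ->
  \int[mu]_(y in D) f y = `|a| * \int[mu]_(x in aff @^-1` D) f (aff x).
Proof.
move=> mD intf; rewrite /Rintegral.
have intfa := integrable_affine mD intf.
have maD := measurable_preimage_affine mD.
have mf := measurable_int _ intf.
rewrite -[RHS]/(fine (`|a|%:E) * _) -fineM//; last exact: integrable_fin_num.
congr fine; rewrite -[LHS]/(\int[mu]_(y in D) (EFin \o f) y)%E [LHS]integralE.
rewrite ge0_integral_affine//; last exact: measurable_funepos.
rewrite [X in (_ - X)%E]ge0_integral_affine//; last exact: measurable_funeneg.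
(* Factoring [|a|] out requires that the difference is not of the form oo - oo; the positive part
   has a finite integral. *)
rewrite -muleBr//; last first.
  apply: fin_num_adde_defr.
  by have := integrable_pos_fin_num maD intfa; rewrite funepos_comp.
congr (_ * _)%E.
rewrite -[RHS]/(\int[mu]_(y in aff @^-1` D) ((EFin \o f) \o aff) y)%E.
by rewrite [RHS]integralE [in RHS]funepos_comp [in RHS]funeneg_comp.
Qed.

End affine_change_of_variable.

(** * Integrability of power singularities and of the Beta kernel *)

Section power_singularity.
Context {R : realType}.
Notation mu := (@lebesgue_measure R).

Lemma powR_continuous (a x : R) : 0 < x ->
  {for x, continuous (fun y : R => y `^ a)}.
Proof.
move=> x0; apply/differentiable_continuous/derivable1_diffP.
by apply: derivable_powR; rewrite in_itv/= x0.
Qed.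

(** The primitive x^p / p gives (T^p - c^p) / p. The bound does not depend on [c], so it survives
    the limit c -> 0. For T <= c the interval is empty or a point and the integral is 0. *)
Lemma integral_powR_le (p c T : R) : 0 < p -> 0 < c -> 0 < T ->
  (\int[mu]_(x in `[c, T]) (x `^ (p - 1))%:E <= (p^-1 * T `^ p)%:E)%E.
Proof.
move=> p0 c0 T0; have [Tc|cT] := leP T c.
  have [->|cT] := eqVneq c T.
    by rewrite set_itv1 integral_set1 lee_fin mulr_ge0 ?invr_ge0 ?powR_ge0 ?ltW.
  rewrite set_itv_ge ?integral_set0 ?lee_fin.
    by rewrite mulr_ge0 ?invr_ge0 ?powR_ge0 ?ltW.
  by rewrite bnd_simp -ltNge lt_neqAle Tc eq_sym cT.
have dF (x : R) : 0 < x ->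
    is_derive x 1 (fun y : R => p^-1 * y `^ p) (x `^ (p - 1)).
  move=> x0; have := @is_derive1_powR R p x x0 => h.
  by apply: is_derive_eq; rewrite -[_ *: _]/(_ * _) mulrA mulVf ?mul1r ?gt_eqF.
have cF (x : R) : 0 < x -> {for x, continuous (fun y : R => p^-1 * y `^ p)}.
  move=> x0; apply/differentiable_continuous/derivable1_diffP.
  by case: (dF _ x0).
rewrite (@continuous_FTC2 _ _ (fun y : R => p^-1 * y `^ p))//.
- rewrite -EFinB lee_fin lerBlDr lerDl.
  by rewrite mulr_ge0 ?invr_ge0 ?powR_ge0 ?ltW.
- apply: continuous_in_subspaceT => x; rewrite inE/= in_itv/= => /andP[cx _].
  by apply: powR_continuous; exact: lt_le_trans cx.
- split.
  + move=> x; rewrite in_itv/= => /andP[cx _].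
    by case: (dF x (lt_trans c0 cx)).
  + by apply: cvg_at_right_filter; exact: cF.
  + by apply: cvg_at_left_filter; exact: cF.
- move=> x; rewrite in_itv/= => /andP[cx _].
  by rewrite derive1E; have [_ ->] := dF x (lt_trans c0 cx).
Qed.

Lemma integrable_powR (p T : R) : 0 < p ->
  mu.-integrable `]0, T[ (EFin \o (fun x : R => x `^ (p - 1))).
Proof.
move=> p0; have [T0|T0] := leP T 0.
  by rewrite set_itv_ge ?bnd_simp -?leNgt//; exact: integrable_set0.
have mpow D : measurable_fun D (fun x : R => (x `^ (p - 1))%:E).
  by apply/measurable_EFinP; apply: measurable_funTS; exact: measurable_powR.
(* Exhaustion by intervals away from the singularity: [x] lies in the one with n = floor (T / x). *)
have sub : `]0, T[ `<=` \bigcup_n `[T / n.+1%:R, T]%classic.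
  move=> x; rewrite /= in_itv/= => /andP[x0 xT].
  exists (Num.truncn (T / x)) => //=; rewrite in_itv/= (ltW xT) andbT.
  by rewrite ler_pdivrMr ?ltr0n// mulrC -ler_pdivrMr//; apply/ltW/truncnS_gt.
apply/integrableP; split; first exact: mpow.
under eq_integral => x _ do rewrite gee0_abs ?lee_fin ?powR_ge0//.
apply: (@le_lt_trans _ _ (p^-1 * T `^ p)%:E); last by rewrite ltry.
apply: (@le_trans _ _ (\int[mu]_(x in \bigcup_n `[(T / n.+1%:R)%R, T]%classic)
    (x `^ (p - 1))%:E)%E).
  apply: ge0_subset_integral => //.
  - exact: bigcup_measurable.
  - exact: mpow.
  - by move=> z _; rewrite lee_fin powR_ge0.
(* Monotone convergence along the exhaustion carries the uniform bound to the union. *)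
have := @ge0_nondecreasing_set_cvg_integral _ (measurableTypeR R) R
  (fun n => `[T / n.+1%:R, T]%classic) (fun x : R => (x `^ (p - 1))%:E) mu.
move=> h0; have h : (\int[mu]_(x in `[(T / i.+1%:R)%R, T]) (x `^ (p - 1))%:E)%E
    @[i --> \oo] --> (\int[mu]_(x in \bigcup_n `[(T / n.+1%:R)%R, T]%classic)
    (x `^ (p - 1))%:E)%E.
  apply: h0 => //.
  - apply/nondecreasing_seqP => n; rewrite subsetEset => x /=.
    rewrite !in_itv/= => /andP[h ->]; rewrite andbT (le_trans _ h)//.
    by rewrite ler_pM2l// lef_pV2 ?posrE// ler_nat.
  - by move=> i; exact: mpow.
  - by move=> i x _; rewrite lee_fin powR_ge0.
rewrite -(cvg_lim _ h)//; apply: lime_le.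
  by apply/cvg_ex; eexists; exact: h.
by apply: nearW => n; apply: integral_powR_le => //; rewrite divr_gt0.
Qed.

(** At each point one of s and 1 - s is at least 1/2, and the power of that one is at most 2. So the
    kernel is dominated by twice the sum of its two factors, each of which is integrable. *)
Lemma integrable_beta_kernel (p q : R) : 0 < p <= 1 -> 0 < q <= 1 ->
  mu.-integrable `]0, 1[
    (EFin \o (fun s : R => (1 - s) `^ (p - 1) * s `^ (q - 1))).
Proof.
move=> /andP[p0 p1] /andP[q0 q1].
(* Reflection s -> 1 - s moves the singularity from 0 to 1. *)
have ip : mu.-integrable `]0, 1[ (EFin \o (fun s : R => (1 - s) `^ (p - 1))).
  have N0 : (-1 : R) != 0 by rewrite oppr_eq0 oner_eq0.
  have := integrable_affine 1 N0 (measurable_itv _) (integrable_powR 1 p0).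
  rewrite (_ : _ @^-1` _ = `]0, 1[%classic); last first.
    by apply/seteqP; split=> x /=; rewrite !in_itv/=; lra.
  apply: eq_integrable => // x _ /=; congr ((_ `^ _)%:E); ring.
have iq := integrable_powR 1 q0.
have m01 : measurable (`]0%R, 1%R[%classic : set (measurableTypeR R)) by [].
have := integrableD m01 (integrableZl m01 2 ip) (integrableZl m01 2 iq).
apply: le_integrable => //.
  apply/measurable_EFinP/measurable_funM; last first.
    by apply: measurable_funTS; exact: measurable_powR.
  by have /measurable_EFinP := measurable_int _ ip.
(* As 0 <= 1 - r < 1, one has x^(1-r) >= (1/2)^(1-r) >= 1/2; then take inverses. *)
have half (r x : R) : 0 < r <= 1 -> 2^-1 <= x -> x `^ (r - 1) <= 2.
  move=> /andP[r0 r1] x2.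
  have x0 : 0 < x by apply: lt_le_trans x2; rewrite invr_gt0.
  have -> : r - 1 = - (1 - r) by rewrite opprB.
  rewrite powRN -[leRHS]invrK lef_pV2 ?posrE ?powR_gt0 ?invr_gt0//.
  apply: (@le_trans _ _ (2^-1 `^ (1 - r))).
    apply: ger1_powR; last lra.
    by rewrite invr_gt0 ltr0n invf_le1// ler1n.
  by rewrite ge0_ler_powR ?nnegrE ?subr_ge0 ?invr_ge0// ltW.
move=> x; rewrite /= in_itv/= => /andP[x0 x1].
have a0 := powR_ge0 (1 - x) (p - 1); have b0 := powR_ge0 x (q - 1).
rewrite lee_fin !ger0_norm ?addr_ge0 ?mulr_ge0 ?powR_ge0//.
have [x2|x2] := leP (2^-1) x.
  have := half q x; rewrite q0 q1 => /(_ isT x2) h.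
  apply: (@le_trans _ _ (2 * (1 - x) `^ (p - 1))).
    by rewrite mulrC ler_wpM2r.
  by rewrite lerDl mulr_ge0.
have := half p (1 - x); rewrite p0 p1 => /(_ isT) h.
apply: (@le_trans _ _ (2 * x `^ (q - 1))); last by rewrite lerDr mulr_ge0.
by rewrite ler_wpM2r// h//; lra.
Qed.

End power_singularity.

(** * Continuous functions on (0,+oo) with a power bound at 0 *)

Section singular_continuous.
Context {R : realType}.
Implicit Types f g h : R -> R.

Definition singular_bound (p : R) f : Prop :=
  forall T : R, exists M : R,
    forall t : R, 0 < t <= T -> `|f t| <= M * t `^ (p - 1).

(** The working class of the whole proof. Unlike [C_m1] it asks only for growth at 0, not for a
    factor continuous up to 0, which makes closure under convolution easy. The cap p <= 1 keeps the
    exponents p - 1 nonpositive, as the Beta kernel estimate expects. *)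
Definition singular_continuous f : Prop :=
  (forall t : R, 0 < t -> {for t, continuous f}) /\
  exists2 p : R, 0 < p <= 1 & singular_bound p f.

Lemma singular_bound_ge0 (p : R) f (T : R) : singular_bound p f ->
  exists2 M : R, 0 <= M &
    forall t : R, 0 < t <= T -> `|f t| <= M * t `^ (p - 1).
Proof.
move=> /(_ T)[M hM]; exists `|M| => // t /hM/le_trans; apply.
by rewrite ler_wpM2r ?powR_ge0// ler_norm.
Qed.

(** On (0,T] one has t^(p-q) <= T^(p-q), which is absorbed in the constant. *)
Lemma singular_bound_le (p q : R) f : q <= p ->
  singular_bound p f -> singular_bound q f.
Proof.
move=> qp fp T; have [M M0 hM] := singular_bound_ge0 T fp.
exists (M * T `^ (p - q)) => t /[dup] /hM/le_trans + /andP[t0 tT]; apply.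
have -> : p - 1 = (p - q) + (q - 1) by ring.
rewrite powRD; last by apply/implyP => _; rewrite gt_eqF.
rewrite mulrA ler_wpM2r ?powR_ge0// ler_wpM2l//.
rewrite ge0_ler_powR ?nnegrE ?subr_ge0//.
  exact: ltW.
by rewrite ltW// (lt_le_trans t0).
Qed.

Lemma eq_singular_continuous f g : (forall t, 0 < t -> f t = g t) ->
  singular_continuous f -> singular_continuous g.
Proof.
move=> fg [cf [p p01 bf]]; split.
- move=> t t0; rewrite /prop_for /continuous_at -fg//.
  apply: cvg_trans (cf t t0); apply: near_eq_cvg; near=> x.
  by apply: fg; near: x; exact: lt_nbhsr.
- exists p => // T; have [M hM] := bf T; exists M => t /[dup] t0T /andP[t0 _].
  by rewrite -fg// hM.
Unshelve. all: by end_near. Qed.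

Lemma singular_continuous_norm f :
  singular_continuous f -> singular_continuous (fun t => `|f t|).
Proof.
move=> [cf [p p01 bf]]; split.
- by move=> t t0; apply: cvg_norm; exact: cf.
- exists p => // T; have [M hM] := bf T; exists M => t /hM.
  by rewrite normr_id.
Qed.

Lemma singular_continuousD f g : singular_continuous f ->
  singular_continuous g -> singular_continuous (fun t => f t + g t).
Proof.
move=> [cf [p /andP[p0 p1] bf]] [cg [q /andP[q0 q1] bg]]; split.
- by move=> t t0; apply: cvgD; [exact: cf|exact: cg].
- exists (Num.min p q); first by rewrite lt_min p0 q0 ge_min p1.
  have pq_p : Num.min p q <= p by rewrite ge_min lexx.
  have pq_q : Num.min p q <= q by rewrite ge_min lexx orbT.
  move=> T; have [M hM] := singular_bound_le pq_p bf T.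
  have [N hN] := singular_bound_le pq_q bg T.
  exists (M + N) => t tT; rewrite mulrDl (le_trans (ler_normD _ _))//.
  by rewrite lerD ?hM ?hN.
Qed.

Lemma singular_continuousZ (c : R) f :
  singular_continuous f -> singular_continuous (fun t => c * f t).
Proof.
move=> [cf [p p01 bf]]; split.
- by move=> t t0; apply: cvgM; [exact: cvg_cst|exact: cf].
- exists p => // T; have [M hM] := bf T; exists (`|c| * M) => t /hM tM.
  by rewrite normrM -mulrA ler_wpM2l.
Qed.

Lemma singular_continuousB f g : singular_continuous f ->
  singular_continuous g -> singular_continuous (fun t => f t - g t).
Proof.
move=> scf scg; under eq_fun do rewrite -mulN1r.
by apply: singular_continuousD => //; exact: singular_continuousZ.
Qed.

Lemma singular_bound_cst (c : R) : singular_bound 1 (fun _ => c).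
Proof. by move=> T; exists `|c| => t _; rewrite subrr powRr0 mulr1. Qed.

Lemma singular_continuous_cst (c : R) : singular_continuous (fun _ => c).
Proof.
split; first by move=> t _; exact: cvg_cst.
by exists 1; [rewrite ltr01 lexx|exact: singular_bound_cst].
Qed.

(** The continuous factor is bounded on each [0,T] by the extreme value theorem, and the exponent is
    lowered to [Num.min p 1]. *)
Lemma C_m1_singular_continuous f : C_m1 f -> singular_continuous f.
Proof.
move=> [p p0 [f1 cf1 ff1]].
apply: (@eq_singular_continuous (fun t => t `^ (p - 1) * f1 t)).
  by move=> t t0; rewrite ff1.
split.
- move=> t t0; apply: cvgM.
    exact: powR_continuous.
  have : {within `]0, +oo[, continuous f1}.
    apply: continuous_subspaceW cf1 => x /=.
    by rewrite !in_itv/= !andbT => /ltW.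
  by rewrite continuous_open_subspace//; apply; rewrite inE/= in_itv/= t0.
- exists (Num.min p 1); first by rewrite lt_min p0 ltr01 ge_min lexx orbT.
  apply: (@singular_bound_le p); first by rewrite ge_min lexx.
  move=> T; have [T0|T0] := leP T 0.
    by exists 0 => t /andP[t0 tT]; have := lt_le_trans t0 tT; rewrite ltNge T0.
  have cf1T : {within `[0, T], continuous (fun x => `|f1 x|)}.
    have : {within `[0, T], continuous f1}.
      apply: continuous_subspaceW cf1 => x /=.
      by rewrite !in_itv/= => /andP[->].
    by move=> h x; apply: cvg_norm; exact: h.
  have [c _ hc] := EVT_max (ltW T0) cf1T.
  exists (`|f1 c|) => t /andP[t0 tT].
  rewrite normrM ger0_norm ?powR_ge0// mulrC ler_wpM2r ?powR_ge0//.
  by apply: hc; rewrite in_itv/= (ltW t0).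
Qed.

Lemma singular_continuous_measurable f :
  singular_continuous f -> measurable_fun (`]0, +oo[%classic : set R) f.
Proof.
move=> [cf _]; apply: open_continuous_measurable_fun => //.
by move=> x; rewrite inE/= in_itv/= andbT; exact: cf.
Qed.

End singular_continuous.

(** * Convolution: convergence, growth, continuity, commutativity, linearity *)

Section convolution.
Context {R : realType}.
Notation mu := (@lebesgue_measure R).
Notation conv := (@Defs.conv R).
Implicit Types f g h : R -> R.

Lemma eq_conv f f' g g' (t : R) : (forall x, 0 < x -> f x = f' x) ->
  (forall x, 0 < x -> g x = g' x) -> conv f g t = conv f' g' t.
Proof.
move=> ff' gg'; apply: eq_Rintegral => x.
rewrite inE/= in_itv/= => /andP[x0 xt].
by rewrite ff' ?subr_gt0// gg'.
Qed.

Lemma eq_conv_defined f f' g g' (t : R) : (forall x, 0 < x -> f x = f' x) ->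
  (forall x, 0 < x -> g x = g' x) -> conv_defined f g t -> conv_defined f' g' t.
Proof.
move=> ff' gg'; apply: eq_integrable => // x.
rewrite inE/= in_itv/= => /andP[x0 xt].
by rewrite ff' ?subr_gt0// gg'.
Qed.

(** After tau = t s the powers of t separate from the Beta kernel in s. The constant is uniform in t
    <= T; this one estimate yields integrability, the growth bound and the dominating function. *)
Lemma scaled_bound (p q : R) f g (T : R) : singular_bound p f ->
  singular_bound q g -> exists2 M : R, 0 <= M & forall t s : R,
    0 < t <= T -> 0 < s < 1 ->
    `|f (t - t * s) * g (t * s)| <=
      M * t `^ (p + q - 2) * ((1 - s) `^ (p - 1) * s `^ (q - 1)).
Proof.
move=> /(singular_bound_ge0 T)[M M0 hM] /(singular_bound_ge0 T)[N N0 hN].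
exists (M * N); first exact: mulr_ge0.
move=> t s /andP[t0 tT] /andP[s0 s1].
have -> : t - t * s = t * (1 - s) by ring.
have s1' : 0 < 1 - s by rewrite subr_gt0.
have -> : p + q - 2 = (p - 1) + (q - 1) by ring.
rewrite powRD; last by apply/implyP => _; rewrite gt_eqF.
rewrite normrM; apply: le_trans (ler_pM _ _ (hM _ _) (hN _ _)) _ => //.
- by rewrite mulr_gt0//= (le_trans _ tT)// ger_pMr//; lra.
- by rewrite mulr_gt0//= (le_trans _ tT)// ger_pMr//; lra.
rewrite !powRM ?(ltW t0) ?(ltW s0) ?(ltW s1')// le_eqVlt.
by apply/orP; left; apply/eqP; ring.
Qed.

Lemma conv_scaled_integrable f g (t : R) :
  singular_continuous f -> singular_continuous g -> 0 < t ->
  mu.-integrable `]0, 1[ (EFin \o (fun s : R => f (t - t * s) * g (t * s))).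
Proof.
move=> scf scg t0.
have [_ [p p01 bf]] := scf; have [_ [q q01 bg]] := scg.
have [M M0 hM] := scaled_bound t bf bg.
have m01 : measurable (`]0%R, 1%R[%classic : set (measurableTypeR R)) by [].
have := integrableZl m01 (M * t `^ (p + q - 2))
  (integrable_beta_kernel p01 q01).
apply: le_integrable => //.
  have m0y : measurable (`]0%R, +oo[%classic : set (measurableTypeR R)) by [].
  apply/measurable_EFinP/measurable_funM.
  - apply: (measurable_comp m0y _ (singular_continuous_measurable scf)).
      move=> _ [x /= /[!in_itv]/= /andP[x0 x1] <-]; rewrite andbT subr_gt0.
      by rewrite gtr_pMr.
    by apply: measurable_funB => //; exact: measurable_funM.
  - apply: (measurable_comp m0y _ (singular_continuous_measurable scg)).
      by move=> _ [x /= /[!in_itv]/= /andP[x0 x1] <-]; rewrite andbT mulr_gt0.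
    exact: measurable_funM.
move=> s; rewrite /= in_itv/= => s01.
rewrite lee_fin (le_trans (hM t s _ s01)) ?t0 ?lexx//.
exact: ler_norm.
Qed.

(** The substitution s = tau / t transports integrability from the unit interval; for t <= 0 the
    domain is empty. *)
Lemma singular_continuous_conv_defined f g (t : R) :
  singular_continuous f -> singular_continuous g -> conv_defined f g t.
Proof.
move=> scf scg; have [t0|t0] := leP t 0.
  rewrite /conv_defined set_itv_ge ?bnd_simp -?leNgt//; exact: integrable_set0.
have tN0 : t^-1 != 0 by rewrite invr_eq0 gt_eqF.
have m01 : measurable (`]0%R, 1%R[%classic : set R) by [].
have := integrable_affine 0 tN0 m01 (conv_scaled_integrable scf scg t0).
rewrite /conv_defined (_ : _ @^-1` _ = `]0, t[%classic); last first.
  apply/seteqP; split=> x /=; rewrite !in_itv/= addr0 mulrC.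
    by rewrite ltr_pdivrMr// mul1r pmulr_lgt0 ?invr_gt0.
  by rewrite ltr_pdivrMr// mul1r pmulr_lgt0 ?invr_gt0.
apply: eq_integrable => // x _ /=.
by rewrite addr0 mulrA divff ?mul1r// gt_eqF.
Qed.

Lemma conv_scale f g (t : R) :
  singular_continuous f -> singular_continuous g -> 0 < t ->
  conv f g t = t * \int[mu]_(s in `]0, 1[) (f (t - t * s) * g (t * s)).
Proof.
move=> scf scg t0; have tN0 : t != 0 by rewrite gt_eqF.
have m0t : measurable (`]0%R, t[%classic : set R) by [].
have ifg := singular_continuous_conv_defined t scf scg.
rewrite /conv (Rintegral_affine 0 tN0 m0t ifg).
rewrite gtr0_norm// (_ : _ @^-1` _ = `]0, 1[%classic); last first.
  apply/seteqP; split=> x /=; rewrite !in_itv/= addr0.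
    by rewrite gtr_pMr// pmulr_rgt0.
  by rewrite gtr_pMr// pmulr_rgt0.
by congr (_ * _); apply: eq_Rintegral => x _; rewrite addr0.
Qed.

(** The Jacobian t of the rescaling raises t^(p+q-2) to t^(p+q-1), and the constant is [M] times the
    Beta integral [B]. The exponent p + q may exceed 1. *)
Lemma conv_singular_bound (p q : R) f g :
  singular_continuous f -> singular_continuous g ->
  0 < p <= 1 -> 0 < q <= 1 -> singular_bound p f -> singular_bound q g ->
  singular_bound (p + q) (conv f g).
Proof.
move=> scf scg p01 q01 bf bg T.
have [M M0 hM] := scaled_bound T bf bg.
have m01 : measurable (`]0%R, 1%R[%classic : set (measurableTypeR R)) by [].
have ib := integrable_beta_kernel p01 q01.
pose B := \int[mu]_(s in `]0, 1[) ((1 - s) `^ (p - 1) * s `^ (q - 1)).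
exists (M * B) => t /[dup] t0T /andP[t0 tT].
have ifg := conv_scaled_integrable scf scg t0.
rewrite conv_scale// normrM gtr0_norm//.
have -> : p + q - 1 = 1 + (p + q - 2) by ring.
rewrite powRD ?powRr1 ?(ltW t0)//; last by apply/implyP => _; rewrite gt_eqF.
have -> : M * B * (t * t `^ (p + q - 2)) = t * (M * t `^ (p + q - 2) * B).
  by ring.
rewrite ler_pM2l// (le_trans (le_normr_Rintegral m01 ifg))//.
rewrite /B -RintegralZl//; apply: le_Rintegral => //.
- exact: integrable_norm ifg.
- exact: (integrableZl m01 (M * t `^ (p + q - 2)) ib).
- by move=> s /=; rewrite in_itv/=; exact: hM.
Qed.

(** In rescaled form the domain of integration is fixed, so continuity under the integral applies,
    with a bound valid on the neighbourhood (t/2, t+1) of t. *)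
Lemma conv_continuous f g (t : R) :
  singular_continuous f -> singular_continuous g -> 0 < t ->
  {for t, continuous (conv f g)}.
Proof.
move=> scf scg t0.
have [cf [p p01 bf]] := scf; have [cg [q q01 bg]] := scg.
have [M M0 hM] := scaled_bound (t + 1) bf bg.
have u0 : 0 < t / 2 by rewrite divr_gt0.
have Itv (l : R) : `]t / 2, t + 1[%classic l -> 0 < l <= t + 1.
  by rewrite /= in_itv/= => /andP[tl /ltW ->]; rewrite (lt_trans u0).
have m01 : measurable (`]0%R, 1%R[%classic : set (measurableTypeR R)) by [].
(* The exponent p + q - 2 is nonpositive, so the power is largest at the left end t/2. *)
pose C := M * (t / 2) `^ (p + q - 2).
have ig := integrableZl m01 C (integrable_beta_kernel p01 q01).
have : {in (`]t / 2, t + 1[%classic : set R), continuous (fun l : R =>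
    \int[mu]_(s in `]0, 1[) (f (l - l * s) * g (l * s)))}.
  apply: (@continuity_under_integral R _ (measurableTypeR R) mu
    (fun l s => f (l - l * s) * g (l * s)) _ m01 (t / 2) (t + 1) _ _ _ ig).
  - by move=> l /Itv/andP[l0 _]; exact: conv_scaled_integrable.
  - apply/aeW => s /=; rewrite in_itv/= => /andP[s0 s1] l.
    move=> /set_mem/Itv/andP[l0 _].
    have cmul : {for l, continuous (fun x : R => x * s)}.
      by apply: cvgM; [exact: cvg_id|exact: cvg_cst].
    apply: cvgM.
      apply: (@continuous_comp _ _ _ (fun x : R => x - x * s) f).
        by apply: cvgB; [exact: cvg_id|exact: cmul].
      by apply: cf; rewrite subr_gt0 gtr_pMr.
    apply: (@continuous_comp _ _ _ (fun x : R => x * s) g) => //.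
    by apply: cg; rewrite mulr_gt0.
  - move=> l /[dup] lI /Itv/[dup] l0t /andP[l0 _]; apply/aeW => s /=.
    rewrite in_itv/= => s01; rewrite (le_trans (hM l s l0t s01))//.
    rewrite ler_wpM2r ?mulr_ge0 ?powR_ge0// ler_wpM2l//.
    have -> : p + q - 2 = - (2 - p - q) by ring.
    rewrite !powRN lef_pV2 ?posrE ?powR_gt0//.
    rewrite ge0_ler_powR ?nnegrE ?(ltW u0) ?(ltW l0)//.
      by move: p01 q01; lra.
    by move: lI; rewrite /= in_itv/= => /andP[/ltW].
move=> /(_ t); rewrite inE/= in_itv/= => /(_ _)/wrap[|ct].
  by lra.
(* The rescaled formula is available at positive points only, hence on a neighbourhood of t. *)
apply: (@cvg_trans _ ((fun l : R => l *
    \int[mu]_(s in `]0, 1[) (f (l - l * s) * g (l * s))) x @[x --> t])).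
  apply: near_eq_cvg; near=> x; rewrite -conv_scale//; near: x; exact: lt_nbhsr.
by rewrite conv_scale//; exact: (cvgM cvg_id ct).
Unshelve. all: by end_near. Qed.

Lemma singular_continuous_conv f g :
  singular_continuous f -> singular_continuous g ->
  singular_continuous (conv f g).
Proof.
move=> scf scg; split; first by move=> t; exact: conv_continuous.
have [_ [p p01 bf]] := scf; have [_ [q q01 bg]] := scg.
(* The exponent p + q is weakened to p to respect the cap at 1. *)
exists p => //; apply: (@singular_bound_le _ (p + q)).
  by move: q01; lra.
exact: conv_singular_bound.
Qed.

(** Substitution tau -> t - tau, which maps (0,t) onto itself. *)
Lemma conv_comm f g (t : R) :
  singular_continuous f -> singular_continuous g -> conv f g t = conv g f t.
Proof.
move=> scf scg; have m0t : measurable (`]0%R, t[%classic : set R) by [].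
have N0 : (-1 : R) != 0 by rewrite oppr_eq0 oner_eq0.
have ifg := singular_continuous_conv_defined t scf scg.
rewrite /conv (Rintegral_affine t N0 m0t ifg).
rewrite normrN1 mul1r (_ : _ @^-1` _ = `]0, t[%classic); last first.
  by apply/seteqP; split=> x /=; rewrite !in_itv/=; lra.
apply: eq_Rintegral => x _; rewrite mulrC; congr (g _ * f _); ring.
Qed.

Lemma convDr f g h (t : R) : singular_continuous f -> singular_continuous g ->
  singular_continuous h ->
  conv f (fun x => g x + h x) t = conv f g t + conv f h t.
Proof.
move=> scf scg sch; rewrite /conv -RintegralD//; first last.
- exact: singular_continuous_conv_defined.
- exact: singular_continuous_conv_defined.
by apply: eq_Rintegral => x _; rewrite mulrDr.
Qed.

Lemma convZr (c : R) f g (t : R) : singular_continuous f ->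
  singular_continuous g -> conv f (fun x => c * g x) t = c * conv f g t.
Proof.
move=> scf scg; rewrite /conv -RintegralZl//; last first.
  exact: singular_continuous_conv_defined.
by apply: eq_Rintegral => x _; rewrite mulrCA.
Qed.

Lemma convBr f g h (t : R) : singular_continuous f ->
  singular_continuous g -> singular_continuous h ->
  conv f (fun x => g x - h x) t = conv f g t - conv f h t.
Proof.
move=> scf scg sch.
under [X in conv f X]eq_fun do rewrite -[- h _]mulN1r.
by rewrite convDr ?convZr ?mulN1r//; exact: singular_continuousZ.
Qed.

Lemma convDl f g h (t : R) : singular_continuous f -> singular_continuous g ->
  singular_continuous h ->
  conv (fun x => f x + g x) h t = conv f h t + conv g h t.
Proof.
move=> scf scg sch; rewrite conv_comm//; last exact: singular_continuousD.
by rewrite convDr// conv_comm// [conv h g t]conv_comm.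
Qed.

Lemma convBl f g h (t : R) : singular_continuous f -> singular_continuous g ->
  singular_continuous h ->
  conv (fun x => f x - g x) h t = conv f h t - conv g h t.
Proof.
move=> scf scg sch; rewrite conv_comm//; last exact: singular_continuousB.
by rewrite convBr// conv_comm// [conv h g t]conv_comm.
Qed.

End convolution.

(** * Associativity by Fubini, and the derivative of a primitive *)

Section convolution_associative.
Context {R : realType}.
Notation mu := (@lebesgue_measure R).
Notation conv := (@Defs.conv R).
Implicit Types f g h : R -> R.

(** Extension by zero turns convolutions into integrals over the whole line, so that Fubini applies
    on the plane and the triangular domain is encoded in the integrand. *)
Let pos f : measurableTypeR R -> R := f \_ `]0, +oo[.

Let posE f (x : R) : pos f x = if 0 < x then f x else 0.
Proof.
by rewrite /pos patchE; congr (if _ then _ else _);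
  apply/idP/idP; rewrite inE/= in_itv/= andbT.
Qed.

Let measurable_pos f : singular_continuous f -> measurable_fun setT (pos f).
Proof.
have m0y : measurable (`]0%R, +oo[%classic : set (measurableTypeR R)) by [].
move=> scf; apply: (measurable_restrictT f m0y).1.
exact: singular_continuous_measurable.
Qed.

Let conv_patch f g (t : R) : (fun s => pos f (t - s) * pos g s) =
  (fun s : R => f (t - s) * g s) \_ `]0, t[.
Proof.
apply/funext => s; rewrite !posE patchE subr_gt0.
have -> : (s \in `]0, t[%classic) = (0 < s) && (s < t).
  by apply/idP/idP; rewrite inE/= in_itv.
by do 2 case: ltP => _ //=; rewrite ?mul0r ?mulr0.
Qed.

Let conv_integrableT f g (t : R) :
  singular_continuous f -> singular_continuous g ->
  mu.-integrable setT (EFin \o (fun s => pos f (t - s) * pos g s)).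
Proof.
move=> scf scg; rewrite conv_patch -restrict_EFin.
apply/(integrable_mkcond _ _).1 => //.
exact: singular_continuous_conv_defined.
Qed.

Let convT f g (t : R) :
  conv f g t = \int[mu]_s (pos f (t - s) * pos g s).
Proof. by rewrite conv_patch -Rintegral_mkcond. Qed.

Let conv_le0 f g (t : R) : t <= 0 -> conv f g t = 0.
Proof.
by move=> t0; rewrite /Defs.conv set_itv_ge ?Rintegral_set0// bnd_simp -leNgt.
Qed.

(** A convolution vanishes at t <= 0, where its domain is empty; hence it can itself be a factor in
    a whole-line convolution. *)
Let pos_conv f g : pos (conv f g) = conv f g.
Proof.
by apply/funext => t; rewrite posE; case: ltP => // t0; rewrite conv_le0.
Qed.

Let integral_conv f g (c t : R) :
  singular_continuous f -> singular_continuous g ->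
  (\int[mu]_s (c * (pos f (t - s) * pos g s))%:E = (c * conv f g t)%:E)%E.
Proof.
move=> scf scg; have ifg := conv_integrableT t scf scg.
under eq_integral do rewrite EFinM.
rewrite integralZl//= EFinM convT /Rintegral fineK//.
exact: integrable_fin_num.
Qed.

(** The inner integral of Fubini in the other order; the translation x -> x - y brings it to a
    convolution at t - y. *)
Let integral_conv_shift f g (c t y : R) :
  singular_continuous f -> singular_continuous g ->
  (\int[mu]_x (pos f (t - x) * pos g (x - y) * c)%:E =
   (conv f g (t - y) * c)%:E)%E.
Proof.
move=> scf scg; have ifg := conv_integrableT (t - y) scf scg.
have mT : measurable (setT : set (measurableTypeR R)) by [].
have E : (fun x => pos f (t - y - (1 * x - y)) * pos g (1 * x - y)) =
    (fun x => pos f (t - x) * pos g (x - y)).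
  by apply/funext => x; congr (pos f _ * pos g _); ring.
have := integrable_affine (- y) (oner_neq0 R) mT ifg.
have := Rintegral_affine (- y) (oner_neq0 R) mT ifg.
rewrite normr1 mul1r preimage_setT -[X in _.-integrable _ X]/(EFin \o _) E.
move=> e i; under eq_integral do rewrite EFinM.
rewrite integralZr//= EFinM convT e /Rintegral fineK//.
exact: integrable_fin_num.
Qed.

(** Both sides are iterated integrals of f(t-x) g(x-y) h(y) over the plane. *)
Lemma conv_assoc f g h (t : R) : singular_continuous f ->
  singular_continuous g -> singular_continuous h ->
  conv f (conv g h) t = conv (conv f g) h t.
Proof.
move=> scf scg sch.
pose F (x : measurableTypeR R * measurableTypeR R) : \bar R :=
  (pos f (t - x.1) * (pos g (x.1 - x.2) * pos h x.2))%:E.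
have mF : measurable_fun setT F.
  apply/measurable_EFinP/measurable_funM; last apply: measurable_funM.
  - apply: (measurableT_comp (measurable_pos scf)).
    by apply: measurable_funB.
  - apply: (measurableT_comp (measurable_pos scg)).
    by apply: measurable_funB.
  - by apply: (measurableT_comp (measurable_pos sch)).
have pos_norm k x : `|pos k x| = pos (fun y => `|k y|) x.
  by rewrite !posE; case: ifP; rewrite ?normr0.
(* Tonelli: the iterated integral of the norm is |f| * (|g| * |h|) at t, finite because the class is
   closed under norms and convolution. *)
have iF : (mu \x mu)%E.-integrable setT F.
  apply/(integrable12ltyP _ _ mF).2.
  under eq_integral => x _.
    under eq_integral => y _.
      rewrite /F/= !normrM !pos_norm; over.
    rewrite integral_conv; [|exact: singular_continuous_norm..].
    rewrite -[conv _ _]pos_conv; over.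
  have sgh : singular_continuous (conv (fun y => `|g y|) (fun y => `|h y|)).
    by apply: singular_continuous_conv; exact: singular_continuous_norm.
  have sf := singular_continuous_norm scf.
  exact: (integrable_lty measurableT (conv_integrableT t sf sgh)).
(* Integrating in y first gives f * (g * h), in x first (f * g) * h. A factor 1 is inserted to match
   the constant in [integral_conv]. *)
have := Fubini iF; rewrite /F/=.
under eq_integral => x _.
  rewrite integral_conv// -[conv _ _]pos_conv -[X in X%:E]mul1r; over.
rewrite integral_conv//; last exact: singular_continuous_conv.
under [in X in _ = X -> _]eq_integral => y _.
  under eq_integral do rewrite mulrA.
  rewrite integral_conv_shift// -[conv _ _]pos_conv -[X in X%:E]mul1r; over.
rewrite integral_conv//; last exact: singular_continuous_conv.
by rewrite !mul1r => -[].
Qed.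

Lemma conv_cst1_is_derive h (t : R) : singular_continuous h -> 0 < t ->
  is_derive t 1 (conv (fun _ => 1) h) (h t).
Proof.
move=> sch t0; have [ch _] := sch.
have ih (u : R) : mu.-integrable `]0, u[ (EFin \o h).
  have := singular_continuous_conv_defined u (singular_continuous_cst 1) sch.
  by apply: eq_integrable => // x _; rewrite /= mul1r.
(* Differentiating at t requires integrability beyond t; the closed end t + 1 is covered by the open
   interval up to t + 2. *)
have iht : mu.-integrable `]0, (t + 1)] (EFin \o h).
  apply: integrableS (ih (t + 2)) => //.
  move=> x /=; rewrite !in_itv/= => /andP[-> x1].
  by rewrite (le_lt_trans x1)// ltrD2l ltr1n.
have -> : conv (fun _ => 1) h =
    (fun u => \int[mu]_(s in [set` Interval (BRight 0) (BRight u)]) h s).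
  apply/funext => u; rewrite -Rintegral_itv_bndo_bndc//.
  by apply: eq_Rintegral => s _; rewrite mul1r.
have tt1 : t < t + 1 by rewrite ltrDl.
have b0t : (BRight 0 < BRight t)%O by rewrite bnd_simp.
have [d dE] := continuous_FTC1 tt1 iht b0t (ch t t0).
by split; [exact: d|rewrite -derive1E dE].
Qed.

End convolution_associative.

(** * The relations for real-valued functions *)

Section fundamental_theorem.
Context {R : realType}.
Notation conv := (@Defs.conv R).
Implicit Types f g h k kappa : R -> R.

(** The difference [g] of f and the primitive of its derivative has zero derivative on (0,+oo), so
    it is constant by the mean value theorem; its value at 1 serves as c. *)
Lemma C1_m1_conv f : C1_m1 f -> exists c : R,
  forall t : R, 0 < t -> f t = c + conv (fun _ => 1) f^`()%classic t.
Proof.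
move=> [df /C_m1_singular_continuous scf'].
pose g t := f t - conv (fun _ => 1) f^`()%classic t.
have dg (t : R) : 0 < t -> is_derive t 1 g 0.
  move=> t0; have dft : is_derive t 1 f (f^`()%classic t).
    by split; [exact: df|rewrite derive1E].
  have dct := conv_cst1_is_derive scf' t0.
  have := is_deriveB dft dct; rewrite subrr; exact.
suff gE (a b : R) : 0 < a -> a <= b -> g a = g b.
  exists (g 1) => t t0; suff -> : g 1 = g t by rewrite /g subrK.
  by have [t1|/ltW t1] := leP 1 t; [exact: gE|apply/esym/gE].
move=> a0 ab; apply/esym/eqP; rewrite -subr_eq0; apply/eqP.
have [x| |x _] := @MVT_segment R g (fun _ => 0) a b ab; last by rewrite mul0r.
  by rewrite in_itv/= => /andP[ax _]; exact: dg (lt_trans a0 ax).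
apply: continuous_in_subspaceT => x; rewrite inE/= in_itv/= => /andP[ax _].
apply/differentiable_continuous/derivable1_diffP.
by case: (dg x (lt_le_trans a0 ax)).
Qed.

(** The constant 1 has exponent 1, so the convolution is O(t^q) with q > 0. The bound on (0,1] is
    enough for a limit at 0. *)
Lemma conv_cst1_cvg0 h : singular_continuous h ->
  conv (fun _ => 1) h t @[t --> 0^'+] --> 0.
Proof.
move=> sch; have [_ [q q01 bh]] := sch.
have sc1 := singular_continuous_cst (1 : R).
have p01 : 0 < (1 : R) <= 1 by rewrite ltr01 lexx.
have [M hM] := conv_singular_bound sc1 sch p01 q01 (singular_bound_cst 1) bh 1.
have cM : M * t `^ q @[t --> 0^'+] --> 0.
  rewrite -[X in _ --> X](mulr0 M); apply: cvgM; first exact: cvg_cst.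
  by apply: powR_cvg0; case/andP: q01.
apply: norm_cvg0.
apply: (@squeeze_cvgr _ _ _ _ (fun _ => 0) (fun t => M * t `^ q)) => //.
  near=> t; have t01 : 0 < t <= 1.
    by apply/andP; split; near: t; [exact: nbhs_right_gt|exact: nbhs_right_le].
  by have := hM t t01; rewrite (_ : 1 + q - 1 = q) ?normr_ge0//; ring.
exact: cvg_cst.
Unshelve. all: by end_near. Qed.

(** The primitive tends to 0 at 0+, so the constant c of [C1_m1_conv] is the limit of f. *)
Lemma C1_m1_val0 f : C1_m1 f -> f t @[t --> 0^'+] --> val0 f /\
  forall t : R, 0 < t -> f t = val0 f + conv (fun _ => 1) f^`()%classic t.
Proof.
move=> /[dup] C1f [_ /C_m1_singular_continuous scf'].
have [c fE] := C1_m1_conv C1f.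
have cc : c + conv (fun _ => 1) f^`()%classic t @[t --> 0^'+] --> c + 0.
  by apply: cvgD; [exact: cvg_cst|exact: conv_cst1_cvg0].
have fc : f t @[t --> 0^'+] --> c.
  rewrite addr0 in cc; apply: cvg_trans cc; apply: near_eq_cvg; near=> t.
  by rewrite fE//; near: t; exact: nbhs_right_gt.
by rewrite /val0 (cvg_lim _ fc).
Unshelve. all: by end_near. Qed.

Lemma C1_m1_singular_continuous f : C1_m1 f -> singular_continuous f.
Proof.
move=> C1f.
apply: (@eq_singular_continuous _
    (fun t => val0 f + conv (fun _ => 1) f^`()%classic t)).
  by move=> t t0; rewrite (C1_m1_val0 C1f).2.
case: C1f => _ /C_m1_singular_continuous scf'.
apply: singular_continuousD; first exact: singular_continuous_cst.
by apply: singular_continuous_conv => //; exact: singular_continuous_cst.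
Qed.

Lemma conv_is_derive k f (t : R) : singular_continuous k -> C1_m1 f -> 0 < t ->
  is_derive t 1 (conv k f) (val0 f * k t + conv k f^`()%classic t).
Proof.
move=> sck C1f t0; have scf' := C_m1_singular_continuous C1f.2.
have sc1 := singular_continuous_cst (1 : R).
have sck' := singular_continuousZ (val0 f) sck.
have sckf := singular_continuous_conv sck scf'.
have sc1f := singular_continuous_conv sc1 scf'.
suff -> : conv k f =
    conv (fun _ => 1) (fun x => val0 f * k x + conv k f^`()%classic x).
  by apply: conv_cst1_is_derive => //; exact: singular_continuousD.
(* The equality holds at every real u, since convolutions see their arguments at positive points
   only. The constant term is written f(0) * 1 below so that [convZr] applies. *)
apply/funext => u; rewrite convDr// convZr// conv_assoc//.
transitivity
  (conv k (fun x => val0 f * 1 + conv (fun _ => 1) f^`()%classic x) u).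
  by apply: eq_conv => // x x0; rewrite mulr1 -(C1_m1_val0 C1f).2.
rewrite convDr//; last exact: singular_continuous_cst.
rewrite (convZr _ _ sck sc1) (conv_assoc _ sck sc1 scf') (conv_comm _ sck sc1).
congr (_ + _); apply: eq_conv => // x x0; exact: conv_comm.
Qed.

Lemma GFD_RLE k f (t : R) : singular_continuous k -> C1_m1 f -> 0 < t ->
  GFD_RL k f t = val0 f * k t + conv k f^`()%classic t.
Proof.
move=> sck C1f t0; rewrite /GFD_RL derive1E.
by have [_ ->] := conv_is_derive sck C1f t0.
Qed.

Lemma real_fundamental_theorem kappa k : C_m1_0 kappa ->
  associate_kernel kappa k ->
  forall f, C1_m1 f ->
     (GFD_C_defined k f /\
      forall t : R, 0 < t ->
        conv_defined kappa (GFD_C k f) t /\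
        GFI kappa (GFD_C k f) t = f t - val0 f) /\
     (GFD_RL_defined k f /\
      forall t : R, 0 < t ->
        conv_defined kappa (GFD_RL k f) t /\
        GFI kappa (GFD_RL k f) t = f t).
Proof.
have C_m1_0_sc (g : R -> R) : C_m1_0 g -> singular_continuous g.
  by move=> [p /andP[p0 _] ?]; apply: C_m1_singular_continuous; exists p.
move=> /C_m1_0_sc sckappa [/C_m1_0_sc sck sonine] f C1f.
have scf := C1_m1_singular_continuous C1f.
have scf' := C_m1_singular_continuous C1f.2.
have sckf := singular_continuous_conv sck scf'.
have sck' := singular_continuousZ (val0 f) sck.
have RL_def : GFD_RL_defined k f.
  move=> t t0; split; first exact: singular_continuous_conv_defined.
  by case: (conv_is_derive sck C1f t0).
have C_eq (t : R) : 0 < t -> conv k f^`()%classic t = GFD_C k f t.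
  by move=> t0; rewrite /GFD_C GFD_RLE// addrC addKr.
have RL_eq (t : R) : 0 < t ->
    val0 f * k t + conv k f^`()%classic t = GFD_RL k f t.
  by move=> t0; rewrite GFD_RLE.
(* Here the Sonine condition replaces kappa * k by the constant 1, leaving the primitive of the
   derivative of f. *)
have kappakf (t : R) : 0 < t ->
    conv kappa (conv k f^`()%classic) t = f t - val0 f.
  move=> t0; rewrite conv_assoc// (C1_m1_val0 C1f).2// addrC addKr.
  exact: eq_conv.
split; split => //.
- by split => //; apply/cvg_ex; exists (val0 f); exact: (C1_m1_val0 C1f).1.
- move=> t t0; split.
    apply: (eq_conv_defined _ C_eq) => //.
    exact: singular_continuous_conv_defined.
  rewrite /GFI -kappakf//; apply: eq_conv => // x x0; exact/esym/C_eq.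
- move=> t t0; split.
    apply: (eq_conv_defined _ RL_eq) => //.
    apply: singular_continuous_conv_defined => //.
    exact: singular_continuousD.
  rewrite /GFI; transitivity
      (conv kappa (fun x => val0 f * k x + conv k f^`()%classic x) t).
    by apply: eq_conv => // x x0; exact/esym/RL_eq.
  by rewrite convDr// convZr// sonine// mulr1 kappakf// addrC subrK.
Qed.

End fundamental_theorem.

(** * The relations for complex-valued functions, by real and imaginary parts *)

Section complex_fundamental_theorem.
Context {R : realType}.
Notation conv := (@Defs.conv R).
Notation re := (@Defs.re R).
Notation im := (@Defs.im R).
Local Open Scope complex_scope.
Implicit Types f g h k kappa : R -> R[i].

Definition csingular_continuous f : Prop :=
  singular_continuous (re f) /\ singular_continuous (im f).

Lemma reD f g : re (fun x => f x + g x) = fun x => re f x + re g x.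
Proof.
by apply/funext => x; rewrite /Defs.re; case: (f x) (g x) => [? ?] [].
Qed.

Lemma imD f g : im (fun x => f x + g x) = fun x => im f x + im g x.
Proof.
by apply/funext => x; rewrite /Defs.im; case: (f x) (g x) => [? ?] [].
Qed.

Lemma reM f g :
  re (fun x => f x * g x) = fun x => re f x * re g x - im f x * im g x.
Proof.
by apply/funext => x; rewrite /Defs.re /Defs.im; case: (f x) (g x) => [? ?] [].
Qed.

Lemma imM f g :
  im (fun x => f x * g x) = fun x => re f x * im g x + im f x * re g x.
Proof.
by apply/funext => x; rewrite /Defs.re /Defs.im; case: (f x) (g x) => [? ?] [].
Qed.

Lemma re_cconv f g (t : R) : csingular_continuous f ->
  csingular_continuous g ->
  re (cconv f g) t = conv (re f) (re g) t - conv (im f) (im g) t.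
Proof.
move=> [rf jf] [rg jg]; rewrite /re /Defs.conv -RintegralB//.
- apply: eq_Rintegral => x _; rewrite /Defs.re /Defs.im /cintegrand.
  by case: (f _) (g _) => [? ?] [? ?].
- exact: singular_continuous_conv_defined rf rg.
- exact: singular_continuous_conv_defined jf jg.
Qed.

Lemma im_cconv f g (t : R) : csingular_continuous f ->
  csingular_continuous g ->
  im (cconv f g) t = conv (re f) (im g) t + conv (im f) (re g) t.
Proof.
move=> [rf jf] [rg jg]; rewrite /im /Defs.conv -RintegralD//.
- apply: eq_Rintegral => x _; rewrite /Defs.re /Defs.im /cintegrand.
  by case: (f _) (g _) => [? ?] [? ?].
- exact: singular_continuous_conv_defined rf jg.
- exact: singular_continuous_conv_defined jf rg.
Qed.

Lemma csingular_continuous_cconv_defined f g (t : R) :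
  csingular_continuous f -> csingular_continuous g -> cconv_defined f g t.
Proof.
move=> [rf jf] [rg jg].
have m0t : measurable (`]0%R, t[%classic : set (measurableTypeR R)) by [].
have D (a b : R -> R) := @singular_continuous_conv_defined R a b t.
split.
- have := integrableB m0t (D _ _ rf rg) (D _ _ jf jg).
  apply: eq_integrable => // x _; rewrite /Defs.re /Defs.im /cintegrand/=.
  by case: (f _) (g _) => [? ?] [? ?].
- have := integrableD m0t (D _ _ rf jg) (D _ _ jf rg).
  apply: eq_integrable => // x _; rewrite /Defs.re /Defs.im /cintegrand/=.
  by case: (f _) (g _) => [? ?] [? ?].
Qed.

Lemma eq_cconv f g g' (t : R) :
  (forall x, 0 < x -> g x = g' x) -> cconv f g t = cconv f g' t.
Proof.
move=> gg'; congr (_ +i* _); apply: eq_Rintegral => x;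
  rewrite inE/= in_itv/= => /andP[x0 xt];
  by rewrite /Defs.re /Defs.im /cintegrand gg'.
Qed.

Lemma eq_csingular_continuous f g : (forall t, 0 < t -> f t = g t) ->
  csingular_continuous f -> csingular_continuous g.
Proof.
move=> fg [rf jf]; split.
- by apply: eq_singular_continuous rf => t t0; rewrite /Defs.re fg.
- by apply: eq_singular_continuous jf => t t0; rewrite /Defs.im fg.
Qed.

Lemma csingular_continuous_cconv f g : csingular_continuous f ->
  csingular_continuous g -> csingular_continuous (cconv f g).
Proof.
move=> scf scg; have [rf jf] := scf; have [rg jg] := scg; split.
- rewrite (_ : re _ = fun t => conv (re f) (re g) t - conv (im f) (im g) t).
    by apply: singular_continuousB; exact: singular_continuous_conv.
  by apply/funext => t; rewrite re_cconv.
- rewrite (_ : im _ = fun t => conv (re f) (im g) t + conv (im f) (re g) t).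
    by apply: singular_continuousD; exact: singular_continuous_conv.
  by apply/funext => t; rewrite im_cconv.
Qed.

Lemma csingular_continuousD f g : csingular_continuous f ->
  csingular_continuous g -> csingular_continuous (fun t => f t + g t).
Proof.
move=> [rf jf] [rg jg].
by split; rewrite ?reD ?imD; exact: singular_continuousD.
Qed.

Lemma csingular_continuousZ (c : R[i]) f :
  csingular_continuous f -> csingular_continuous (fun t => c * f t).
Proof.
move=> [rf jf]; split; rewrite ?reM ?imM.
- by apply: singular_continuousB; exact: singular_continuousZ.
- by apply: singular_continuousD; exact: singular_continuousZ.
Qed.

Lemma eq_complex_reim f g (t : R) :
  re f t = re g t -> im f t = im g t -> f t = g t.
Proof.
by rewrite /Defs.re /Defs.im; case: (f t) (g t) => [? ?] [? ?] /= -> ->.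
Qed.

(** Each part expands into four real triple convolutions, which real associativity matches one by
    one. *)
Lemma cconv_assoc f g h (t : R) : csingular_continuous f ->
  csingular_continuous g -> csingular_continuous h ->
  cconv f (cconv g h) t = cconv (cconv f g) h t.
Proof.
move=> scf scg sch.
have [rf jf] := scf; have [rg jg] := scg; have [rh jh] := sch.
have scgh := csingular_continuous_cconv scg sch.
have scfg := csingular_continuous_cconv scf scg.
have C (a b : R -> R) := @singular_continuous_conv R a b.
have reE u v : csingular_continuous u -> csingular_continuous v ->
    re (cconv u v) = (fun t => conv (re u) (re v) t - conv (im u) (im v) t).
  by move=> su sv; apply/funext => x; rewrite re_cconv.
have imE u v : csingular_continuous u -> csingular_continuous v ->
    im (cconv u v) = (fun t => conv (re u) (im v) t + conv (im u) (re v) t).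
  by move=> su sv; apply/funext => x; rewrite im_cconv.
have A (u v w : R -> R) := @conv_assoc R u v w t.
apply: eq_complex_reim.
- rewrite !re_cconv// !reE// !imE// convBr ?convDr ?convBl ?convDl;
    try exact: C; try by [].
  rewrite !A//.
  (* The four triple convolutions become atoms for [ring]. *)
  by move: (conv _ _ t) (conv _ _ t) (conv _ _ t) (conv _ _ t) => *; ring.
- rewrite !im_cconv// !reE// !imE// convBr ?convDr ?convBl ?convDl;
    try exact: C; try by [].
  rewrite !A//.
  by move: (conv _ _ t) (conv _ _ t) (conv _ _ t) (conv _ _ t) => *; ring.
Qed.

Lemma cconvDr f g h (t : R) : csingular_continuous f ->
  csingular_continuous g -> csingular_continuous h ->
  cconv f (fun x => g x + h x) t = cconv f g t + cconv f h t.
Proof.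
move=> scf scg sch.
have [rf jf] := scf; have [rg jg] := scg; have [rh jh] := sch.
have scgh := csingular_continuousD scg sch.
apply: (@eq_complex_reim _ (fun t => cconv f g t + cconv f h t)).
- by rewrite reD !re_cconv// reD imD !convDr//; ring.
- by rewrite imD !im_cconv// reD imD !convDr//; ring.
Qed.

Lemma cconvZr (c : R[i]) f g (t : R) : csingular_continuous f ->
  csingular_continuous g -> cconv f (fun x => c * g x) t = c * cconv f g t.
Proof.
move=> scf scg; have [rf jf] := scf; have [rg jg] := scg.
have sccg := csingular_continuousZ c scg.
have Z (d : R) (u : R -> R) := @singular_continuousZ R d u.
(* [B] and [A] treat the combinations that occur as real and imaginary parts of c g. *)
have B (a b : R) (v u w : R -> R) : singular_continuous v ->
    singular_continuous u -> singular_continuous w ->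
    conv v (fun x => a * u x - b * w x) t =
    a * conv v u t - b * conv v w t.
  by move=> sv su sw; rewrite convBr ?convZr//; exact: Z.
have A (a b : R) (v u w : R -> R) : singular_continuous v ->
    singular_continuous u -> singular_continuous w ->
    conv v (fun x => a * u x + b * w x) t =
    a * conv v u t + b * conv v w t.
  by move=> sv su sw; rewrite convDr ?convZr//; exact: Z.
apply: (@eq_complex_reim _ (fun t => c * cconv f g t)).
- rewrite reM re_cconv// reM imM re_cconv// im_cconv// B// A//.
  by set a := re _ t; set b := im _ t; ring.
- rewrite imM im_cconv// reM imM re_cconv// im_cconv// B// A//.
  by set a := re _ t; set b := im _ t; ring.
Qed.

(** The power factor is real, so both parts inherit the exponent p. *)
Lemma cC_m1_reim f : cC_m1 f -> C_m1 (re f) /\ C_m1 (im f).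
Proof.
move=> [p p0 [f1 [rf1 jf1] fE]]; split; exists p => //.
- exists (re f1) => // t t0; rewrite /Defs.re fE//; case: (f1 t) => x y /=.
  by rewrite mul0r subr0.
- exists (im f1) => // t t0; rewrite /Defs.im fE//; case: (f1 t) => x y /=.
  by rewrite mul0r addr0.
Qed.

Lemma cC_m1_csingular_continuous f : cC_m1 f -> csingular_continuous f.
Proof.
by move=> /cC_m1_reim[rf jf]; split; exact: C_m1_singular_continuous.
Qed.

Lemma cC1_m1_reim f : cC1_m1 f -> C1_m1 (re f) /\ C1_m1 (im f).
Proof.
move=> [df /cC_m1_reim[rf' jf']]; split; split => // t t0.
- by have [] := df t t0.
- by have [] := df t t0.
Qed.

(** Each part of k * f is a signed sum of two real convolutions; their derivatives by
    [conv_is_derive] regroup into the parts of the complex formula. *)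
Lemma cconv_is_derive k f (t : R) : csingular_continuous k -> cC1_m1 f ->
  0 < t ->
  is_derive t 1 (re (cconv k f))
    (re (fun x => cval0 f * k x + cconv k (cderive f) x) t) /\
  is_derive t 1 (im (cconv k f))
    (im (fun x => cval0 f * k x + cconv k (cderive f) x) t).
Proof.
move=> /[dup] sck [rk jk] /[dup] C1f /cC1_m1_reim[rf jf] t0.
have scf : csingular_continuous f.
  by split; exact: C1_m1_singular_continuous.
have scf' := cC_m1_csingular_continuous C1f.2.
have D (a b : R -> R) sa sb := @conv_is_derive R a b t sa sb t0.
split.
- have -> : re (cconv k f) = conv (re k) (re f) \- conv (im k) (im f).
    by apply/funext => x; rewrite re_cconv.
  apply: is_derive_eq; first exact: is_deriveB (D _ _ rk rf) (D _ _ jk jf).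
  by rewrite reD reM re_cconv// opprD addrACA.
- have -> : im (cconv k f) = conv (re k) (im f) \+ conv (im k) (re f).
    by apply/funext => x; rewrite im_cconv.
  apply: is_derive_eq; first exact: is_deriveD (D _ _ rk jf) (D _ _ jk rf).
  rewrite imD imM im_cconv// addrACA; congr (_ + _).
  exact: addrC.
Qed.

Lemma cGFD_RLE k f (t : R) : csingular_continuous k -> cC1_m1 f -> 0 < t ->
  cGFD_RL k f t = cval0 f * k t + cconv k (cderive f) t.
Proof.
move=> sck C1f t0; have [[_ dr] [_ di]] := cconv_is_derive sck C1f t0.
apply: (@eq_complex_reim _ (fun t => cval0 f * k t + cconv k (cderive f) t)).
- by rewrite -dr /Defs.re/= derive1E.
- by rewrite -di /Defs.im/= derive1E.
Qed.

Lemma cconv_cst1 g (t : R) : cconv (fun _ => 1) g t =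
  (conv (fun _ => 1) (re g) t +i* conv (fun _ => 1) (im g) t).
Proof.
congr (_ +i* _); apply: eq_Rintegral => x _;
  by rewrite /Defs.re /Defs.im /cintegrand !mul1r.
Qed.

Lemma complex_fundamental_theorem kappa k : cC_m1_0 kappa ->
  cassociate_kernel kappa k ->
  forall f, cC1_m1 f ->
     (cGFD_C_defined k f /\
      forall t : R, 0 < t ->
        cconv_defined kappa (cGFD_C k f) t /\
        cGFI kappa (cGFD_C k f) t = f t - cval0 f) /\
     (cGFD_RL_defined k f /\
      forall t : R, 0 < t ->
        cconv_defined kappa (cGFD_RL k f) t /\
        cGFI kappa (cGFD_RL k f) t = f t).
Proof.
have cC_m1_0_sc (g : R -> R[i]) : cC_m1_0 g -> csingular_continuous g.
  by move=> [p /andP[p0 _] ?]; apply: cC_m1_csingular_continuous; exists p.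
move=> /cC_m1_0_sc sckappa [/cC_m1_0_sc sck sonine] f C1f.
have subK (a b c d : R) : ((a + b) +i* (c + d)) - (a +i* c) = b +i* d.
  by apply/eqP; rewrite eq_complex/= ![_ - _]addrC !addKr !eqxx.
have [C1rf C1jf] := cC1_m1_reim C1f.
have scf : csingular_continuous f.
  by split; exact: C1_m1_singular_continuous.
have scf' := cC_m1_csingular_continuous C1f.2.
have sckf := csingular_continuous_cconv sck scf'.
have sck' := csingular_continuousZ (cval0 f) sck.
have RL_def : cGFD_RL_defined k f.
  move=> t t0; split; first exact: csingular_continuous_cconv_defined.
  by have [[dr _] [di _]] := cconv_is_derive sck C1f t0; exact: (conj dr di).
have RL_eq (t : R) : 0 < t ->
    cval0 f * k t + cconv k (cderive f) t = cGFD_RL k f t.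
  by move=> t0; rewrite cGFD_RLE.
have C_eq (t : R) : 0 < t -> cconv k (cderive f) t = cGFD_C k f t.
  by move=> t0; rewrite /cGFD_C -RL_eq// addrC addKr.
have kappakf (t : R) : 0 < t ->
    cconv kappa (cconv k (cderive f)) t = f t - cval0 f.
  move=> t0; rewrite cconv_assoc//.
  (* The left factor changes here, whereas [eq_cconv] replaces the right one; hence the comparison
     of integrands by hand. *)
  transitivity (cconv (fun _ => 1) (cderive f) t).
    congr (_ +i* _); apply: eq_Rintegral => x;
      rewrite inE/= in_itv/= => /andP[x0 xt];
      by rewrite /Defs.re /Defs.im /cintegrand sonine// subr_gt0.
  rewrite cconv_cst1//.
  (* The real representation of f by its initial value and derivative is used on each part, and
     [subK] cancels the initial values. *)
  have := (C1_m1_val0 C1rf).2 t t0; have := (C1_m1_val0 C1jf).2 t t0.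
  rewrite /cval0 {1}/Defs.re {1}/Defs.im; case: (f t) => x y /= -> ->.
  exact/esym/subK.
split; split => //.
- split => //; split; apply/cvg_ex; eexists.
    exact: (C1_m1_val0 C1rf).1.
  exact: (C1_m1_val0 C1jf).1.
- move=> t t0; split; last first.
    by rewrite /cGFI -kappakf//; apply: eq_cconv => // x x0; exact/esym/C_eq.
  apply: csingular_continuous_cconv_defined => //.
  exact: eq_csingular_continuous sckf.
- have sckkf := csingular_continuousD sck' sckf.
  move=> t t0; split.
    apply: csingular_continuous_cconv_defined => //.
    exact: eq_csingular_continuous sckkf.
  rewrite /cGFI -(@eq_cconv kappa _ (cGFD_RL k f) _ RL_eq).
  by rewrite cconvDr// cconvZr// sonine// mulr1 kappakf// addrC subrK.
Qed.

End complex_fundamental_theorem.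

Theorem theorem4p2 (R : realType) :
  (forall kappa k : R -> R, S_m1 kappa -> associate_kernel kappa k ->
   forall f : R -> R, C1_m1 f ->
     (GFD_C_defined k f /\
      forall t : R, 0 < t ->
        conv_defined kappa (GFD_C k f) t /\
        GFI kappa (GFD_C k f) t = f t - val0 f) /\
     (GFD_RL_defined k f /\
      forall t : R, 0 < t ->
        conv_defined kappa (GFD_RL k f) t /\
        GFI kappa (GFD_RL k f) t = f t)) /\
  (forall kappa k : R -> R[i], cS_m1 kappa -> cassociate_kernel kappa k ->
   forall f : R -> R[i], cC1_m1 f ->
     (cGFD_C_defined k f /\
      forall t : R, 0 < t ->
        cconv_defined kappa (cGFD_C k f) t /\
        cGFI kappa (cGFD_C k f) t = f t - cval0 f) /\
     (cGFD_RL_defined k f /\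
      forall t : R, 0 < t ->
        cconv_defined kappa (cGFD_RL k f) t /\
        cGFI kappa (cGFD_RL k f) t = f t)).
Proof.
split=> kappa k [Hkappa _]; first exact: real_fundamental_theorem.
exact: complex_fundamental_theorem.
Qed.
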